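(* Let $R=k[[x_1,\dots,x_n]]$ and let $I,J\subset R$ be ideals. Assume there exists an isomorphism of $k$-algebras $\phi:R\to R$ such that $\phi(I)=J$. Then for every integer $m\ge 1$, $\phi$ induces an isomorphism $R/I^{m\text{-}jc}\cong R/J^{m\text{-}jc}$.
   Context: $k$ is an algebraically closed field of characteristic $0$, and $\mathfrak m$ is the maximal ideal of $R$. For an integer $m\ge 0$ put $P_m=k[x_i^{(j)}: 1\le i\le n,\ 1\le j\le m]$. For $g\in R$ define $D_0(g),\dots,D_m(g)\in P_m$ by $$g\Big(\sum_{j=1}^m x_1^{(j)}t^j,\dots,\sum_{j=1}^m x_n^{(j)}t^j\Big)\equiv\sum_{j=0}^m D_j(g)\,t^j \pmod{t^{m+1}}.$$ For an ideal $I\subset R$ let $\overline{I}_m\subset P_m$ be the ideal generated by all $D_j(g)$ with $g\in I$, $0\le j\le m$. (Here $P_m$ is the $m$-th jet ring $R_m$ modulo $\mathfrak m R_m$, and $\overline I_m$ is the image of the $m$-th jet ideal of $I$.) The $m$-th jet closure of $I$ is $$I^{m\text{-}jc}=\{f\in R: D_j(f)\in \overline I_m \text{ for all } 0\le j\le m\}.$$ *)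

(* Defs.v *)
From HB Require Import structures.
From mathcomp Require Import all_boot all_order all_algebra.
From mathcomp Require Import boolp classical_sets.
From mathcomp Require Import mpoly.

Set Implicit Arguments.
Unset Strict Implicit.
Unset Printing Implicit Defensive.

Import GRing.Theory.

Local Open Scope classical_set_scope.
Local Open Scope ring_scope.
Local Open Scope quotient_scope.

Record mpseries (n : nat) (k : Type) : Type :=
  MPSeries { mpscoef : 'X_{1..n} -> k }.

Section MPSeriesStructures.
Variables (n : nat) (k : comNzRingType).
Implicit Types (f g h : mpseries n k) (m : 'X_{1..n}).

Lemma mpsP f g : mpscoef f =1 mpscoef g -> f = g.
Proof. by case: f g => [f] [g] /= /funext ->. Qed.

HB.instance Definition _ := gen_eqMixin (mpseries n k).
HB.instance Definition _ := gen_choiceMixin (mpseries n k).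

Definition mps_zero : mpseries n k := MPSeries (fun=> 0).
Definition mps_opp f := MPSeries (fun m => - mpscoef f m).
Definition mps_add f g := MPSeries (fun m => mpscoef f m + mpscoef g m).
Definition mps_one : mpseries n k := MPSeries (fun m => (m == 0%MM)%:R).
Definition mps_mul f g := MPSeries (fun m =>
  \sum_(a : 'X_{1..n < (mdeg m).+1, (mdeg m).+1} | m == (a.1 + a.2)%MM)
    mpscoef f a.1 * mpscoef g a.2).
Definition mps_scale (c : k) f := MPSeries (fun m => c * mpscoef f m).

Fact mps_addA : associative mps_add.
Proof. by move=> f g h; apply: mpsP => m /=; rewrite addrA. Qed.
Fact mps_addC : commutative mps_add.
Proof. by move=> f g; apply: mpsP => m /=; rewrite addrC. Qed.
Fact mps_add0 : left_id mps_zero mps_add.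
Proof. by move=> f; apply: mpsP => m /=; rewrite add0r. Qed.
Fact mps_addN : left_inverse mps_zero mps_opp mps_add.
Proof. by move=> f; apply: mpsP => m /=; rewrite addNr. Qed.

HB.instance Definition _ := GRing.isZmodule.Build (mpseries n k)
  mps_addA mps_addC mps_add0 mps_addN.

Definition mpstrunc (d : nat) f : {mpoly k[n]} :=
  \sum_(a : 'X_{1..n < d.+1}) mpscoef f a *: 'X_[a].

Lemma mcoeff_mpstrunc d f m : (mdeg m <= d)%N -> (mpstrunc d f)@_m = mpscoef f m.
Proof. by move=> le_md; rewrite mcoeff_mpoly. Qed.

Lemma mcoeffM_low (p p' q q' : {mpoly k[n]}) m :
    (forall a, (mdeg a <= mdeg m)%N -> p@_a = p'@_a) ->
    (forall a, (mdeg a <= mdeg m)%N -> q@_a = q'@_a) ->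
  (p * q)@_m = (p' * q')@_m.
Proof.
move=> Ep Eq; rewrite !mcoeffM; apply: eq_bigr => a _.
by rewrite Ep ?Eq // -ltnS bmdeg.
Qed.

Lemma mps_mulE d f g m : (mdeg m <= d)%N ->
  mpscoef (mps_mul f g) m = (mpstrunc d f * mpstrunc d g)@_m.
Proof.
move=> le_md; rewrite mcoeffM; apply: eq_bigr => a _.
by rewrite !mcoeff_mpstrunc // (leq_trans _ le_md) // -ltnS bmdeg.
Qed.

Fact mps_mulA : associative mps_mul.
Proof.
move=> f g h; apply: mpsP => m; rewrite !(mps_mulE _ _ (leqnn (mdeg m))).
transitivity ((mpstrunc (mdeg m) f * (mpstrunc (mdeg m) g * mpstrunc (mdeg m) h))@_m).
  by apply: mcoeffM_low => // a le_a; rewrite mcoeff_mpstrunc // (mps_mulE _ _ le_a).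
rewrite mulrA.
by apply: mcoeffM_low => // a le_a; rewrite mcoeff_mpstrunc // (mps_mulE _ _ le_a).
Qed.
Fact mps_mulC : commutative mps_mul.
Proof.
by move=> f g; apply: mpsP => m; rewrite !(mps_mulE _ _ (leqnn (mdeg m))) mulrC.
Qed.
Fact mps_mul1 : left_id mps_one mps_mul.
Proof.
move=> f; apply: mpsP => m; rewrite !(mps_mulE _ _ (leqnn (mdeg m))).
rewrite -(mcoeff_mpstrunc f (leqnn (mdeg m))) -[in RHS](mul1r (mpstrunc _ f)).
by apply: mcoeffM_low => // a le_a; rewrite mcoeff_mpstrunc // mcoeff1.
Qed.
Fact mps_mulDl : left_distributive mps_mul mps_add.
Proof.
move=> f g h; apply: mpsP => m /=; rewrite -big_split /=.
by apply: eq_bigr => a _; rewrite mulrDl.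
Qed.
Fact mps_one_neq0 : mps_one != mps_zero.
Proof.
apply/eqP => /(congr1 (fun f => mpscoef f 0%MM)) /=; rewrite eqxx => /eqP.
by rewrite oner_eq0.
Qed.

HB.instance Definition _ := GRing.Zmodule_isComNzRing.Build (mpseries n k)
  mps_mulA mps_mulC mps_mul1 mps_mulDl mps_one_neq0.

Fact mps_scaleA (a b : k) f : mps_scale a (mps_scale b f) = mps_scale (a * b) f.
Proof. by apply: mpsP => m /=; rewrite mulrA. Qed.
Fact mps_scale1 : left_id 1 mps_scale.
Proof. by move=> f; apply: mpsP => m /=; rewrite mul1r. Qed.
Fact mps_scaleDr : right_distributive mps_scale +%R.
Proof. by move=> a f g; apply: mpsP => m /=; rewrite mulrDr. Qed.
Fact mps_scaleDl f : {morph mps_scale^~ f : a b / a + b}.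
Proof. by move=> a b; apply: mpsP => m /=; rewrite mulrDl. Qed.

HB.instance Definition _ := GRing.Zmodule_isLmodule.Build k (mpseries n k)
  mps_scaleA mps_scale1 mps_scaleDr mps_scaleDl.

Fact mps_scaleAl (a : k) f g : a *: (f * g) = (a *: f) * g.
Proof.
apply: mpsP => m /=; rewrite mulr_sumr.
by apply: eq_bigr => b _; rewrite mulrA.
Qed.

HB.instance Definition _ := GRing.Lmodule_isLalgebra.Build k (mpseries n k)
  mps_scaleAl.
HB.instance Definition _ := GRing.Lalgebra_isComAlgebra.Build k (mpseries n k).

Lemma mpscoef0 m : mpscoef (0 : mpseries n k) m = 0. Proof. by []. Qed.
Lemma mpscoefD f g m : mpscoef (f + g) m = mpscoef f m + mpscoef g m.
Proof. by []. Qed.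
Lemma mpscoefZ (c : k) f m : mpscoef (c *: f) m = c * mpscoef f m.
Proof. by []. Qed.
Lemma mpscoefM d f g m : (mdeg m <= d)%N ->
  mpscoef (f * g) m = (mpstrunc d f * mpstrunc d g)@_m.
Proof. exact: mps_mulE. Qed.

End MPSeriesStructures.

(* The ideals of the library's ring_quotient are proper, hence this notion:
   the unit ideal, whose quotient is the zero ring, is allowed here. *)

Definition is_ideal (R : comPzRingType) (A : set R) : Prop :=
  [/\ A 0, forall x y, A x -> A y -> A (x + y) & forall a x, A x -> A (a * x)].

Record ideal (R : comPzRingType) : Type :=
  Ideal { ideal_set :> set R; ideal_setP : is_ideal ideal_set }.

Definition ideal_mem (R : comPzRingType) (A : ideal R) : {pred R} :=
  fun x => `[< ideal_set A x >].

Section IdealQuotient.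
Variables (R : comPzRingType) (A : ideal R).

Lemma ideal_memP x : reflect (ideal_set A x) (x \in ideal_mem A).
Proof. exact: asboolP. Qed.

Lemma ideal_memMl a x : x \in ideal_mem A -> a * x \in ideal_mem A.
Proof.
by move=> /ideal_memP Ax; apply/ideal_memP; case: (ideal_setP A) => _ _; apply.
Qed.

Fact ideal_mem_zmod_closed : zmod_closed (ideal_mem A).
Proof.
have [A0 AD AM] := ideal_setP A.
split=> [|x y /ideal_memP Ax /ideal_memP Ay]; apply/ideal_memP => //.
by apply: (AD x (- y)) => //; rewrite -mulN1r; apply: AM.
Qed.

HB.instance Definition _ :=
  GRing.isZmodClosed.Build R (ideal_mem A) ideal_mem_zmod_closed.

Definition ideal_quot : Type := Quotient.quot (ideal_mem A).

HB.instance Definition _ := Choice.on ideal_quot.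
HB.instance Definition _ := EqQuotient.on ideal_quot.
HB.instance Definition _ := GRing.Zmodule.on ideal_quot.
HB.instance Definition _ := ZmodQuotient.on ideal_quot.

Lemma ideal_quotP x y :
  reflect (ideal_set A (x - y)) (\pi_ideal_quot x == \pi_ideal_quot y).
Proof. by rewrite -Quotient.idealrBE; apply: ideal_memP. Qed.

Definition ideal_quot_one : ideal_quot := \pi_ideal_quot 1.
Definition ideal_quot_mul := lift_op2 ideal_quot *%R.

Lemma ideal_quot_pi_mul x y :
  ideal_quot_mul (\pi_ideal_quot x) (\pi_ideal_quot y) = \pi_ideal_quot (x * y).
Proof.
have repr_sub z : z - repr (\pi_ideal_quot z) \in ideal_mem A.
  by apply/ideal_memP; apply/ideal_quotP; rewrite reprK.
unlock ideal_quot_mul; apply/esym/eqP/ideal_quotP; apply/ideal_memP.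
set x' := repr _; set y' := repr _.
have -> : x * y - x' * y' = y * (x - x') + x' * (y - y').
  by rewrite !mulrBr [y * x]mulrC [y * x']mulrC addrA subrK.
by apply: rpredD; apply: ideal_memMl; apply: repr_sub.
Qed.

Fact ideal_quot_mulA : associative ideal_quot_mul.
Proof.
move=> u v w; rewrite -[u]reprK -[v]reprK -[w]reprK.
by rewrite !ideal_quot_pi_mul mulrA.
Qed.
Fact ideal_quot_mulC : commutative ideal_quot_mul.
Proof.
by move=> u v; rewrite -[u]reprK -[v]reprK !ideal_quot_pi_mul mulrC.
Qed.
Fact ideal_quot_mul1 : left_id ideal_quot_one ideal_quot_mul.
Proof.
by move=> u; rewrite -[u]reprK -[ideal_quot_one]/(\pi_ideal_quot 1)
  ideal_quot_pi_mul mul1r.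
Qed.
Fact ideal_quot_mulDl : left_distributive ideal_quot_mul +%R.
Proof.
move=> u v w; rewrite -[u]reprK -[v]reprK -[w]reprK.
by rewrite -!pi_addr !ideal_quot_pi_mul -pi_addr mulrDl.
Qed.

HB.instance Definition _ := GRing.Zmodule_isComPzRing.Build ideal_quot
  ideal_quot_mulA ideal_quot_mulC ideal_quot_mul1 ideal_quot_mulDl.

Lemma ideal_quot_piM :
  {morph \pi_ideal_quot : x y / x * y >-> x * y}.
Proof. by move=> x y; rewrite -ideal_quot_pi_mul. Qed.

End IdealQuotient.

Section IdealQuotientLmodule.
Variables (k : comNzRingType) (R : comAlgType k) (A : ideal R).
Local Notation Q := (ideal_quot A).

Definition ideal_quot_scale (c : k) := lift_op1 Q ( *:%R c).

Lemma ideal_quot_pi_scale c x :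
  ideal_quot_scale c (\pi_Q x) = \pi_Q (c *: x).
Proof.
unlock ideal_quot_scale; apply/esym/eqP/ideal_quotP; apply/ideal_memP.
rewrite -scalerBr -mulr_algl ideal_memMl //.
by apply/ideal_memP; apply/ideal_quotP; rewrite reprK.
Qed.

Fact ideal_quot_scaleA a b u :
  ideal_quot_scale a (ideal_quot_scale b u) = ideal_quot_scale (a * b) u.
Proof. by rewrite -[u]reprK !ideal_quot_pi_scale scalerA. Qed.
Fact ideal_quot_scale1 : left_id 1 ideal_quot_scale.
Proof. by move=> u; rewrite -[u]reprK !ideal_quot_pi_scale scale1r. Qed.
Fact ideal_quot_scaleDr : right_distributive ideal_quot_scale +%R.
Proof.
move=> a u v; rewrite -[u]reprK -[v]reprK.
by rewrite -!pi_addr !ideal_quot_pi_scale -pi_addr scalerDr.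
Qed.
Fact ideal_quot_scaleDl u : {morph ideal_quot_scale^~ u : a b / a + b}.
Proof.
by move=> a b; rewrite -[u]reprK !ideal_quot_pi_scale -pi_addr scalerDl.
Qed.

HB.instance Definition _ := GRing.Zmodule_isLmodule.Build k Q
  ideal_quot_scaleA ideal_quot_scale1 ideal_quot_scaleDr ideal_quot_scaleDl.

Lemma ideal_quot_piZ : scalable \pi_Q.
Proof. by move=> c x; rewrite -ideal_quot_pi_scale. Qed.

End IdealQuotientLmodule.

Section JetClosure.
Variables (n : nat) (k : comNzRingType) (m : nat).
Local Notation R := (mpseries n k).
Local Notation P := {mpoly k[n * m]}.

(* The variable x_i^(j+1) of P is 'X_(mxvec_index i j). *)
Definition jet_arc (i : 'I_n) : {poly P} :=
  \sum_(j < m) ('X_(mxvec_index i j))%:P * 'X^(j.+1).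

(* Since t divides every [jet_arc i], the terms of g of degree > m do not
   contribute modulo t^(m+1): substituting in the truncation of g is enough. *)
Definition jet_subst (g : R) : {poly P} :=
  mmap (polyC \o @mpolyC (n * m) k) jet_arc (mpstrunc m g).

Definition jet_coef (j : nat) (g : R) : P := (jet_subst g)`_j.

Definition jet_ideal (I : set R) : set P :=
  smallest (@is_ideal P)
    [set h | exists g j, [/\ I g, (j <= m)%N & h = jet_coef j g]].

Definition jet_closure_set (I : set R) : set R :=
  [set f | forall j, (j <= m)%N -> jet_ideal I (jet_coef j f)].

Lemma jet_ideal_is_ideal (I : set R) : is_ideal (jet_ideal I).
Proof.
split=> [A [[A0 _ _] _] //|x y Ix Iy A AI|a x Ix A AI].
  by case: (AI) => -[_ AD _] _; apply: AD; [apply: Ix|apply: Iy].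
by case: (AI) => -[_ _ AM] _; apply: AM; apply: Ix.
Qed.

Lemma mmap_jet_arc_low (p : {mpoly k[n]}) (j : nat) : (j <= m)%N ->
    (forall a, (mdeg a <= m)%N -> p@_a = 0) ->
  (mmap (polyC \o @mpolyC (n * m) k) jet_arc p)`_j = 0.
Proof.
move=> le_jm p0; rewrite /mmap coef_sum big1_seq // => a /= ap.
have lt_ma : (m < mdeg a)%N.
  by rewrite ltnNge; apply: contraL ap => /p0/eqP; rewrite mcoeff_eq0.
have arcE i : jet_arc i = (\sum_(l < m) ('X_(mxvec_index i l))%:P * 'X^l) * 'X.
  by rewrite mulr_suml; apply: eq_bigr => l _; rewrite exprSr mulrA.
rewrite /mmap1 (eq_bigr (fun i => (\sum_(l < m) ('X_(mxvec_index i l))%:P * 'X^l)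
  ^+ a i * 'X^(a i))); last by move=> i _; rewrite arcE exprMn.
rewrite big_split /= prodrXr -mdegE mulrA coefMXn.
by rewrite (leq_ltn_trans le_jm lt_ma).
Qed.

Lemma jet_coefE (j d : nat) (g : R) : (j <= m <= d)%N ->
  jet_coef j g =
    (mmap (polyC \o @mpolyC (n * m) k) jet_arc (mpstrunc d g))`_j.
Proof.
move=> /andP[le_jm le_md]; apply/eqP; rewrite -subr_eq0 -coefB -mmapB.
apply/eqP/mmap_jet_arc_low => // a le_am.
by rewrite mcoeffB !mcoeff_mpstrunc ?subrr // (leq_trans le_am).
Qed.

Lemma jet_coef0 j : jet_coef j 0 = 0.
Proof.
rewrite /jet_coef /jet_subst (_ : mpstrunc m 0 = 0) ?mmap0 ?coef0 //.
by rewrite /mpstrunc big1 // => a _; rewrite mpscoef0 scale0r.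
Qed.

Lemma jet_coefD j f g : jet_coef j (f + g) = jet_coef j f + jet_coef j g.
Proof.
rewrite /jet_coef /jet_subst -coefD -mmapD.
suff -> : mpstrunc m (f + g) = mpstrunc m f + mpstrunc m g by [].
by rewrite -big_split; apply: eq_bigr => a _; rewrite mpscoefD scalerDl.
Qed.

Lemma jet_coefM j f g : (j <= m)%N ->
  jet_coef j (f * g) = \sum_(i < j.+1) jet_coef i f * jet_coef (j - i) g.
Proof.
move=> le_jm; rewrite -coefM -rmorphM; apply/eqP.
rewrite -subr_eq0 -coefB -mmapB; apply/eqP/mmap_jet_arc_low => // a le_am.
by rewrite mcoeffB mcoeff_mpstrunc // (mpscoefM _ _ le_am) subrr.
Qed.

Lemma jet_closure_is_ideal (I : set R) : is_ideal (jet_closure_set I).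
Proof.
have [I0 ID IM] := jet_ideal_is_ideal I.
split=> [j _|f g If Ig j le_jm|a f If j le_jm].
- by rewrite jet_coef0.
- by rewrite jet_coefD; apply: ID; [apply: If|apply: Ig].
rewrite jet_coefM //; elim/big_ind: _ => // i _; apply: IM; apply: If.
exact: leq_trans (leq_subr _ _) le_jm.
Qed.

Definition jet_closure (I : set R) : ideal R := Ideal (jet_closure_is_ideal I).

End JetClosure.

(* Main.v *)
Require Import Defs.
From HB Require Import structures.
From mathcomp Require Import all_boot all_order all_algebra.
From mathcomp Require Import boolp classical_sets.
From mathcomp Require Import mpoly.

(** An algebra automorphism [phi] of the power series ring acts on jets. As the
    ring is local, [phi] maps the maximal ideal into itself ([lrmorph_local]),
    so composing a truncated arc through the origin with [phi] gives another
    such arc. On coordinate rings this is an endomorphism [jet_map] of [P_m]: it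
    sends the coordinate [x_i^(j)] to the [j]-th jet coefficient of [phi x_i].

    The key point is that the jet coefficients commute with [phi]:
    [D_j (phi f) = jet_map (D_j f)] for every [j <= m] ([jet_coef_morph]). Both
    sides agree on constants and on the variables and obey the same Leibniz rule,
    but a power series is not a finite polynomial expression in the variables.
    Instead of truncating and arguing by continuity, write
    [f = c + x_1 f_1 + ... + x_n f_n] ([mps_peel]). Because [D_0 x_i = 0], the
    coefficient [D_j (x_i f_i)] only involves [D_l f_i] with [l < j], and strong
    induction on [j], for all series at once, concludes.

    Hence [jet_map] sends the jet ideal of [I] into that of [J] as soon as [phi]
    sends [I] into [J], and [phi] sends the jet closure of [I] into that of [J].
    The same applies to the inverse of [phi], which is again an algebra
    morphism, so [phi] and its inverse induce mutually inverse morphisms between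
    the two quotients. *)

Set Implicit Arguments.
Unset Strict Implicit.
Unset Printing Implicit Defensive.

Import GRing.Theory.

Local Open Scope classical_set_scope.
Local Open Scope ring_scope.
Local Open Scope quotient_scope.

(** * Power series: inverses, variables and local morphisms *)

Section Order.
Variables (n : nat) (k : comNzRingType).
Implicit Types (f g h : mpseries n k) (a : 'X_{1..n}) (i : 'I_n) (d e : nat).

Lemma mpscoefN f a : mpscoef (- f) a = - mpscoef f a.
Proof. by []. Qed.

Lemma mpscoef1 a : mpscoef (1 : mpseries n k) a = (a == 0%MM)%:R.
Proof. by []. Qed.

Lemma mpscoef_sum (T : Type) (r : seq T) (P : pred T) (F : T -> mpseries n k) a :
  mpscoef (\sum_(x <- r | P x) F x) a = \sum_(x <- r | P x) mpscoef (F x) a.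
Proof. exact: (big_morph (fun f => mpscoef f a)). Qed.

Lemma mpscoefM_low f f' g g' a :
    (forall b, (mdeg b <= mdeg a)%N -> mpscoef f b = mpscoef f' b) ->
    (forall b, (mdeg b <= mdeg a)%N -> mpscoef g b = mpscoef g' b) ->
  mpscoef (f * g) a = mpscoef (f' * g') a.
Proof.
move=> Ef Eg; apply: eq_bigr => b _.
by rewrite Ef ?Eg // -ltnS bmdeg.
Qed.

(** Membership in the [d]-th power of the maximal ideal, read off the
    coefficients. *)
Definition order_ge d f := forall a, (mdeg a < d)%N -> mpscoef f a = 0.

Lemma order_geM d e f g :
  order_ge d f -> order_ge e g -> order_ge (d + e) (f * g).
Proof.
move=> of_ og a lt_a; apply: big1 => -[b c] /= /eqP Ea.
case: (ltnP (mdeg b) d) => [/of_->|le_db]; first by rewrite mul0r.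
rewrite og ?mulr0 // -(ltn_add2l (mdeg b)) -mdegD -Ea.
by apply: leq_trans lt_a _; rewrite leq_add2r.
Qed.

Lemma order_geX d f e : order_ge d f -> order_ge (e * d) (f ^+ e).
Proof.
move=> of_; elim: e => [|e IHe] //.
by rewrite exprS mulSn; apply: order_geM.
Qed.

Lemma order_ge1P f : order_ge 1 f <-> mpscoef f 0%MM = 0.
Proof.
split=> [of_|f0 a]; first by apply: of_; rewrite mdeg0.
by rewrite ltnS leqn0 mdeg_eq0 => /eqP->.
Qed.

Lemma mpscoefM0 f g :
  mpscoef (f * g) 0%MM = mpscoef f 0%MM * mpscoef g 0%MM.
Proof.
rewrite (mpscoefM_low (f' := mpscoef f 0%MM *: 1) (g' := g)) //.
  by rewrite -scalerAl mul1r mpscoefZ.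
move=> b; rewrite mdeg0 leqn0 mdeg_eq0 => /eqP->.
by rewrite mpscoefZ mpscoef1 eqxx mulr1.
Qed.

(** The inverse is the geometric series. It makes sense because [h ^+ e] has
    order at least [e], so that each coefficient of the infinite sum is already
    that of a partial sum, and [(1 - h) * \sum_(i < d) h ^+ i = 1 - h ^+ d]. *)
Lemma mps_inv1B h : order_ge 1 h -> exists g, (1 - h) * g = 1.
Proof.
move=> oh; pose s d : mpseries n k := \sum_(i < d) h ^+ i.
have coef_s d a : (mdeg a < d)%N -> mpscoef (s d) a = mpscoef (s (mdeg a).+1) a.
  move=> lt_ad; rewrite /s -(subnKC lt_ad) big_split_ord /=.
  rewrite [X in _ + X]mpscoef_sum [X in _ + X]big1 ?addr0 // => i _.
  by apply: (order_geX (e := (mdeg a).+1 + i) oh); rewrite muln1 leq_addr.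
exists (MPSeries (fun a => mpscoef (s (mdeg a).+1) a)); apply: mpsP => a.
rewrite (mpscoefM_low (f' := 1 - h) (g' := s (mdeg a).+1)) //; last first.
  by move=> b le_ba /=; rewrite coef_s.
rewrite -[1 - h]opprB mulNr -subrX1 opprB mpscoefD mpscoefN.
by rewrite (order_geX (e := (mdeg a).+1) oh) ?muln1 ?subr0.
Qed.

Definition mpsvar i : mpseries n k := MPSeries (fun a => (a == U_(i)%MM)%:R).

Lemma mpscoef_varM i f a :
  mpscoef (mpsvar i * f) a =
    if (0 < a i)%N then mpscoef f (a - U_(i))%MM else 0.
Proof.
rewrite (mpscoefM _ _ (leqnn (mdeg a))).
transitivity (('X_i * mpstrunc (mdeg a) f)@_a).
  apply: mcoeffM_low => // b le_ba.
  by rewrite mcoeff_mpstrunc // mcoeffX eq_sym.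
case: ifPn => [a_gt0|].
  have Ea : a = (U_(i) + (a - U_(i)))%MM.
    by rewrite addmC submK //; apply/mnm_lepP => j; rewrite mnm1E; case: eqP => // <-.
  rewrite mulrC [X in _@_X]Ea mcoeffMX mcoeff_mpstrunc //.
  by rewrite {2}Ea mdegD leq_addl.
rewrite -leqNgt leqn0 => /eqP a0; rewrite mcoeffM big1 // => -[b c] /= /eqP Ea.
rewrite mcoeffX; case: eqP => [Eb|_]; last by rewrite mul0r.
move/(congr1 (fun b : 'X_{1..n} => b i)): Ea.
by rewrite /= a0 mnmDE -Eb mnm1E eqxx.
Qed.

(** A monomial other than 1 is shared out to the first variable it contains:
    [mpsvar i * peel i f] collects the terms of [f] whose first variable is
    [x_i], so that each term is counted once. *)
Definition peel i f : mpseries n k :=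
  MPSeries (fun a =>
    if [forall j : 'I_n, (j < i)%N ==> (a j == 0)%N]
    then mpscoef f (a + U_(i))%MM else 0).

Lemma mps_peel f :
  f = mpscoef f 0%MM *: 1 + \sum_(i < n) mpsvar i * peel i f.
Proof.
apply: mpsP => a; rewrite mpscoefD mpscoefZ mpscoef1 mpscoef_sum.
under eq_bigr do rewrite mpscoef_varM.
case: (eqVneq a 0%MM) => [->|a_neq0].
  by rewrite mulr1 big1 ?addr0 // => i _; rewrite mnm0E.
have [i a_gt0 min_i] :
    exists2 i : 'I_n, (0 < a i)%N & forall j : 'I_n, (0 < a j)%N -> (i <= j)%N.
  have /existsP[i0 a_gt0] : [exists i, (0 < a i)%N].
    apply: contraR a_neq0; rewrite negb_exists => /forallP a0.
    apply/eqP/mnmP => i; rewrite mnm0E; apply/eqP.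
    by rewrite -leqn0 leqNgt.
  case: (@arg_minnP _ i0 (fun i => 0 < a i)%N (fun i => i : nat) a_gt0) => i.
  by exists i.
(* Only the first variable [x_i] of [a] contributes. *)
rewrite mulr0 add0r (bigD1 i) //= a_gt0 big1 ?addr0 => [|j neq_ji].
  have -> : [forall j : 'I_n, (j < i)%N ==> ((a - U_(i))%MM j == 0)%N].
    apply/forallP => j; apply/implyP => lt_ji; rewrite mnmBE.
    rewrite (_ : a j = 0%N) //; apply/eqP; rewrite -leqn0 leqNgt.
    by apply: contraL lt_ji => /min_i; rewrite -leqNgt.
  by rewrite submK //; apply/mnm_lepP => j; rewrite mnm1E; case: eqP => // <-.
case: ifP => // /min_i le_ij; case: ifP => // /forallP/(_ i).
rewrite ltn_neqAle le_ij eq_sym neq_ji /= mnmBE mnm1E (negPf neq_ji) subn0.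
by rewrite eqn0Ngt a_gt0.
Qed.

End Order.

Section LocalMorphism.
Variables (k : fieldType) (n : nat).
Variable phi : {lrmorphism mpseries n k -> mpseries n k}.

(** If [phi f] had a nonzero constant term [c], the invertible series
    [1 - f / c] would be sent to a series without constant term, which is not
    invertible. *)
Lemma lrmorph_local f : mpscoef f 0%MM = 0 -> mpscoef (phi f) 0%MM = 0.
Proof.
move=> f0; set c := mpscoef (phi f) 0%MM; apply/eqP; apply: contraT => c_neq0.
have [|g fg1] := @mps_inv1B n k (c^-1 *: f).
  by apply/order_ge1P; rewrite mpscoefZ f0 mulr0.
have phiE : phi (1 - c^-1 *: f) = 1 - c^-1 *: phi f.
  by rewrite rmorphB rmorph1 /= linearZZ.
have /(congr1 (fun h => mpscoef h 0%MM)) := congr1 phi fg1.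
rewrite rmorphM rmorph1 mpscoefM0 [X in mpscoef X _ * _]phiE.
rewrite mpscoefD mpscoefN mpscoefZ.
rewrite mpscoef1 eqxx -/c mulVf // subrr mul0r => /eqP.
by rewrite eq_sym oner_eq0.
Qed.

End LocalMorphism.

(** * Functoriality of jets *)

Section JetCoef.
Variables (n : nat) (k : comNzRingType) (m : nat).
Implicit Types (f : mpseries n k) (i : 'I_n) (j : nat).

Lemma jet_coef_sum j (T : Type) (r : seq T) (F : T -> mpseries n k) :
  jet_coef m j (\sum_(x <- r) F x) = \sum_(x <- r) jet_coef m j (F x).
Proof.
exact: (big_morph (jet_coef m j) (jet_coefD m j) (jet_coef0 n k m j)).
Qed.

(** Only the terms of degree at most [m] of a series matter, so that its jets
    are those of any polynomial with the same terms in these degrees. *)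
Lemma jet_coef_mpoly j f (p : {mpoly k[n]}) : (j <= m)%N ->
    (forall a, (mdeg a <= m)%N -> mpscoef f a = p@_a) ->
  jet_coef m j f = (mmap (polyC \o @mpolyC (n * m) k) (jet_arc k m) p)`_j.
Proof.
move=> le_jm Efp; apply/eqP; rewrite -subr_eq0 -coefB -mmapB; apply/eqP.
apply: mmap_jet_arc_low => // a le_am.
by rewrite mcoeffB mcoeff_mpstrunc // Efp // subrr.
Qed.

Lemma jet_coefC j (c : k) : (j <= m)%N ->
  jet_coef m j (c *: 1 : mpseries n k) = if j == 0%N then c%:MP else 0.
Proof.
move=> le_jm; rewrite (jet_coef_mpoly (p := c%:MP) le_jm); last first.
  by move=> a _; rewrite mpscoefZ mpscoef1 mcoeffC eq_sym.
by rewrite mmapC coefC.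
Qed.

Lemma jet_coef_var j i : (j <= m)%N ->
  jet_coef m j (mpsvar k i) = (jet_arc k m i)`_j.
Proof.
move=> le_jm; rewrite (jet_coef_mpoly (p := 'X_i) le_jm); last first.
  by move=> a _; rewrite mcoeffX eq_sym.
by rewrite mmapX mmap1U.
Qed.

Lemma coef_jet_arc0 i : (jet_arc k m i)`_0 = 0.
Proof.
by rewrite coef_sum big1 // => j _; rewrite coefCM coefXn mulr0.
Qed.

Lemma coef_jet_arcS i (j : 'I_m) :
  (jet_arc k m i)`_j.+1 = 'X_(mxvec_index i j).
Proof.
rewrite coef_sum (bigD1 j) //= coefCM coefXn eqxx mulr1 big1 ?addr0 // => l.
by move=> neq_lj; rewrite coefCM coefXn eqSS val_eqE eq_sym (negPf neq_lj) mulr0.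
Qed.

(** Since [jet_coef m 0 (mpsvar k i) = 0], the [j]-th coefficient of a multiple
    of a variable only involves the lower coefficients of the cofactor. *)
Lemma jet_coef_varM j i f : (j <= m)%N ->
  jet_coef m j (mpsvar k i * f) =
    \sum_(l < j) (jet_arc k m i)`_l.+1 * jet_coef m (j - l.+1) f.
Proof.
move=> le_jm; rewrite jet_coefM // big_ord_recl jet_coef_var // coef_jet_arc0.
rewrite mul0r add0r; apply: eq_bigr => l _.
by rewrite jet_coef_var // (leq_trans (ltn_ord l) le_jm).
Qed.

Lemma jet_coef_const f : jet_coef m 0 f = (mpscoef f 0%MM)%:MP.
Proof.
(* The sums of [jet_coef_varM] are empty in degree 0. *)
rewrite {1}[f]mps_peel jet_coefD jet_coefC // jet_coef_sum big1 ?addr0 // => i _.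
by rewrite jet_coef_varM // big_ord0.
Qed.

End JetCoef.

Section JetMorphism.
Variables (k : fieldType) (n m : nat).
Variable phi : {lrmorphism mpseries n k -> mpseries n k}.
Local Notation P := {mpoly k[n * m]}.

(** The comorphism of the map that [phi] induces on the space of [m]-jets at
    the origin. The images of the variables form a matrix, flattened by [mxvec]
    because the variables of [P] are indexed through [mxvec_index]. *)
Definition jet_map : P -> P :=
  mmap (@mpolyC (n * m) k)
    (mxvec (\matrix_(i < n, j < m) jet_coef m j.+1 (phi (mpsvar k i))) 0).

HB.instance Definition _ := GRing.RMorphism.on jet_map.

Lemma jet_mapC c : jet_map c%:MP = c%:MP.
Proof. exact: mmapC. Qed.

Lemma jet_map_var i (j : 'I_m) :
  jet_map 'X_(mxvec_index i j) = jet_coef m j.+1 (phi (mpsvar k i)).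
Proof. by rewrite /jet_map mmapX mmap1U mxvecE mxE. Qed.

(** The case of variables in [jet_coef_morph]. Locality of [phi] is what makes
    it true for [j = 0]: the arcs have no constant term, while there is no
    coordinate of [P] to be sent to the constant term of [phi (mpsvar k i)]. *)
Lemma jet_map_arc i j : (j <= m)%N ->
  jet_map (jet_arc k m i)`_j = jet_coef m j (phi (mpsvar k i)).
Proof.
case: j => [_|j lt_jm].
  rewrite coef_jet_arc0 rmorph0 jet_coef_const lrmorph_local ?mpolyC0 //=.
  by rewrite eq_sym; case: eqP => // /(congr1 mdeg); rewrite mdeg1 mdeg0.
by rewrite (coef_jet_arcS _ _ (Ordinal lt_jm)) jet_map_var.
Qed.

(** The compatibility of [jet_map] with [phi], by strong induction on [j]: in
    the decomposition [mps_peel] of [f], the coefficient of index [j] of each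
    [mpsvar k i * peel i f] only involves those of [peel i f] of smaller index. *)
Lemma jet_coef_morph j f : (j <= m)%N ->
  jet_coef m j (phi f) = jet_map (jet_coef m j f).
Proof.
elim/ltn_ind: j f => j IHj f le_jm.
rewrite [in LHS](mps_peel f) [in RHS](mps_peel f) linearD linearZZ rmorph1.
rewrite linear_sum !jet_coefD [RHS]rmorphD !jet_coef_sum rmorph_sum; congr (_ + _).
  rewrite !jet_coefC //; case: ifP => _; last by rewrite rmorph0.
  exact/esym/jet_mapC.
apply: eq_bigr => i _; rewrite rmorphM jet_coef_varM // jet_coefM //.
(* The term with index 0 vanishes, so the induction hypothesis applies to all
   the others. *)
rewrite big_ord_recl -jet_map_arc // coef_jet_arc0 rmorph0 mul0r add0r rmorph_sum.
apply: eq_bigr => l _; rewrite [RHS]rmorphM; congr (_ * _).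
  exact/esym/jet_map_arc/(leq_trans (ltn_ord l)).
apply: IHj; last exact: leq_trans (leq_subr _ _) le_jm.
by rewrite ltn_subrL (leq_ltn_trans _ (ltn_ord l)).
Qed.

(** The preimage under [jet_map] of the jet ideal of [J] is an ideal, and it
    contains the generators of the jet ideal of [I] by [jet_coef_morph]. *)
Lemma jet_ideal_map (I J : set (mpseries n k)) (h : P) :
    (forall f, I f -> J (phi f)) ->
  jet_ideal I h -> jet_ideal J (jet_map h).
Proof.
move=> phiIJ; apply: (smallest_sub (X := [set h | jet_ideal J (jet_map h)])).
  have [J0 JD JM] := @jet_ideal_is_ideal n k m J; split=> /=.
  - by rewrite rmorph0.
  - by move=> x y Jx Jy; rewrite rmorphD; apply: JD.
  - by move=> a x Jx; rewrite rmorphM; apply: JM.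
move=> _ [g [j [Ig le_jm ->]]] /=; rewrite -jet_coef_morph //.
apply: sub_gen_smallest; exists (phi g), j; split=> //.
exact: phiIJ.
Qed.

Lemma jet_closure_morph (I J : set (mpseries n k)) f :
    (forall g, I g -> J (phi g)) ->
  jet_closure_set m I f -> jet_closure_set m J (phi f).
Proof.
move=> phiIJ If j le_jm; rewrite jet_coef_morph //.
exact: jet_ideal_map phiIJ (If j le_jm).
Qed.

End JetMorphism.

(** * Morphisms between quotients *)

Section QuotientMorphism.
Variables (R S : comPzRingType) (A : ideal R) (B : ideal S).
Variables (phi : {rmorphism R -> S}).
Hypothesis phiAB : forall x, ideal_set A x -> ideal_set B (phi x).

Definition ideal_quot_map (u : ideal_quot A) : ideal_quot B :=
  \pi_(ideal_quot B) (phi (repr u)).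

Lemma ideal_quot_map_pi x :
  ideal_quot_map (\pi_(ideal_quot A) x) = \pi_(ideal_quot B) (phi x).
Proof.
apply/eqP/ideal_quotP; rewrite -rmorphB; apply: phiAB.
by apply/ideal_quotP; rewrite reprK.
Qed.

Fact ideal_quot_map_is_zmod_morphism : zmod_morphism ideal_quot_map.
Proof.
move=> u v; rewrite -[u]reprK -[v]reprK -pi_oppr -pi_addr !ideal_quot_map_pi.
by rewrite rmorphB pi_addr pi_oppr.
Qed.

Fact ideal_quot_map_is_monoid_morphism : monoid_morphism ideal_quot_map.
Proof.
split=> [|u v]; first by rewrite ideal_quot_map_pi rmorph1.
rewrite -[u]reprK -[v]reprK -ideal_quot_piM !ideal_quot_map_pi.
by rewrite rmorphM ideal_quot_piM.
Qed.

Definition ideal_quot_rmorphism : {rmorphism ideal_quot A -> ideal_quot B} :=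
  HB.pack ideal_quot_map
    (GRing.isZmodMorphism.Build _ _ _ ideal_quot_map_is_zmod_morphism)
    (GRing.isMonoidMorphism.Build _ _ _ ideal_quot_map_is_monoid_morphism).

End QuotientMorphism.

Lemma ideal_quot_mapK (R S : comPzRingType) (A : ideal R) (B : ideal S)
    (phi : {rmorphism R -> S}) (phi' : {rmorphism S -> R}) :
    (forall y, ideal_set B y -> ideal_set A (phi' y)) -> cancel phi phi' ->
  cancel (@ideal_quot_map R S A B phi) (@ideal_quot_map S R B A phi').
Proof.
by move=> phiBA phiK u; rewrite [LHS](ideal_quot_map_pi phiBA) phiK reprK.
Qed.

Theorem proposition3p1 (k : closedFieldType) (char_k : [pchar k] =i pred0)
    (n : nat) (I J : ideal (mpseries n k))
    (phi : {lrmorphism mpseries n k -> mpseries n k})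
    (bij_phi : bijective phi)
    (phi_IJ : phi @` I = J) (m : nat) (m_gt0 : (1 <= m)%N) :
  exists psi : {rmorphism ideal_quot (jet_closure m I)
                          -> ideal_quot (jet_closure m J)},
    [/\ scalable psi, bijective psi
      & forall f, psi (\pi_(ideal_quot (jet_closure m I)) f)
                    = \pi_(ideal_quot (jet_closure m J)) (phi f)].
Proof.
have [phi' phiK phi'K] := bij_phi.
pose phi'_lr : {lrmorphism mpseries n k -> mpseries n k} :=
  HB.pack phi'
    (GRing.isZmodMorphism.Build _ _ phi' (can2_zmod_morphism phiK phi'K))
    (GRing.isMonoidMorphism.Build _ _ phi' (can2_monoid_morphism phiK phi'K))
    (GRing.isScalable.Build _ _ _ _ phi' (can2_scalable phiK phi'K)).
have phiIJ f : ideal_set I f -> ideal_set J (phi f).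
  by rewrite -phi_IJ => If; exists f.
have phi'JI f : ideal_set J f -> ideal_set I (phi'_lr f).
  by rewrite -phi_IJ => -[g Ig <-]; rewrite /= phiK.
have clIJ f := @jet_closure_morph k n m phi I J f phiIJ.
have clJI f := @jet_closure_morph k n m phi'_lr J I f phi'JI.
exists (@ideal_quot_rmorphism _ _ (jet_closure m I) (jet_closure m J) phi clIJ).
split=> [c u||f]; last exact: ideal_quot_map_pi.
  rewrite -[u in LHS]reprK -ideal_quot_piZ [LHS]ideal_quot_map_pi //.
  rewrite -ideal_quot_piZ; apply: (congr1 \pi_(ideal_quot _)).
  exact: linearZZ.
exists (@ideal_quot_map _ _ (jet_closure m J) (jet_closure m I) phi'_lr).
  exact: (@ideal_quot_mapK _ _ (jet_closure m I) (jet_closure m J)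
    phi phi'_lr clJI phiK).
exact: (@ideal_quot_mapK _ _ (jet_closure m J) (jet_closure m I)
  phi'_lr phi clIJ phi'K).
Qed.
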